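(* For all natural $k$ and all complex $\rho$ and $\beta$ (and, in (iii)–(v), all integers $n\ge 0$) the following identities hold. (i) $$\frac{(2k)!}{k!}(1+\rho)^{k}=\sum_{j=0}^{k}\binom{2k}{2j}(1+\rho)^{2k-2j}(1-\rho^{2})^{j}(2j-1)!!\,(2k-2j-1)!!.$$ (ii) $$(1+\rho)^{k}=\frac{1}{2^{k}}\sum_{j=0}^{2k}\sum_{m=0}^{\lfloor j/2\rfloor}(2\rho)^{j-2m}\binom{k}{j-2m}\binom{k-j+2m}{m}.$$ (iii) For all integer $m$, $$\sum_{j=0}^{n}(-1)^{j}\binom{n}{j}\frac{(\beta)^{(j+m)}}{(\beta)^{(j)}}=(-1)^{n}\,n!\binom{m}{n}\frac{(\beta)^{(m)}}{(\beta)^{(n)}}.$$ (iv) $$\sum_{m=0}^{n}(-1)^{m}\binom{n}{m}(\beta)^{(m)}(\beta)^{(n-m)}\sum_{k=0}^{m}\binom{m}{k}\binom{n-m}{k}\frac{\rho^{k}\,k!}{(\beta)^{(k)}}=\begin{cases}0 & \text{if } n \text{ is odd},\\[2pt] \dfrac{n!}{(n/2)!}(\beta)^{(n/2)}(1-\rho)^{n/2} & \text{if } n\text{ is even}.\end{cases}$$ (v) $$\sum_{m=0}^{n}(-1)^{n-m}\binom{n}{m}\sum_{j=0}^{m}\binom{m}{j}(1-\rho)^{j}\rho^{m-j}(\beta)^{(n-j)}(\beta+m-j)^{(j)}=\begin{cases}0 & \text{if } n \text{ is odd},\\[2pt] \dfrac{n!}{(n/2)!}(\beta)^{(n/2)}(1-\rho)^{n/2}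 & \text{if } n\text{ is even}.\end{cases}$$
   Context: The rising factorial (Pochhammer symbol) is $(x)^{(n)}=x(x+1)\cdots(x+n-1)$, defined for all complex $x$; for $x\neq 0$ one has $(x)^{(n)}=\Gamma(x+n)/\Gamma(x)$, where $\Gamma$ is Euler's gamma function. For an odd integer $r\ge 1$, $r!!=r(r-2)\cdots 3\cdot 1$, and by convention $(-1)!!=0!!=1$. $\binom{n}{k}$ denotes the binomial coefficient, with the convention $\binom{n}{k}=0$ when $n<k$. $\lfloor x\rfloor$ denotes the integer part of $x$.
   Formalization: In (iii), for negative m the binomial is m(m-1)...(m-n+1)/n! instead of 0 (with 0 the identity fails, e.g. m=-1, n=1), and beta is restricted to values where the quotients are defined: beta not in {0,...,-(n-1)}, nor in {1,...,-m} if m<0. *)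

(* Defs.v *)
From HB Require Import structures.
From mathcomp Require Export all_boot all_order all_algebra.
From mathcomp Require Export reals.
From mathcomp Require Export complex.

Set Implicit Arguments.
Unset Strict Implicit.
Unset Printing Implicit Defensive.

Import Order.TTheory GRing.Theory Num.Theory.
Local Open Scope ring_scope.

Definition rise (F : fieldType) (x : F) (n : nat) : F :=
  \prod_(i < n) (x + i%:R).

(* Rising factorial of integer order, Gamma(x + m) / Gamma(x). For m = - p < 0
   this is 1 / ((x - p)(x - p + 1)...(x - 1)); it is meaningful only when x is
   not one of 1, ..., p. *)
Definition risez (F : fieldType) (x : F) (m : int) : F :=
  match m with
  | Posz n => rise x n
  | Negz p => (rise (x - p.+1%:R) p.+1)^-1
  end.

(* Binomial coefficient with integer upper argument,
   m (m - 1) ... (m - n + 1) / n!. It is 'C(m, n) for m >= 0, in particular 0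
   when 0 <= m < n. *)
Definition binz {F : fieldType} (m : int) (n : nat) : F :=
  (\prod_(i < n) (m - i%:Z))%:~R / n`!%:R.

Fixpoint dfactn (n : nat) : nat :=
  match n with
  | n'.+2 => n * dfactn n'
  | _ => 1
  end.

(* Only the negative argument -1 is meaningful: (-1)!! = 1. *)
Definition dfact (r : int) : nat :=
  match r with
  | Posz n => dfactn n
  | Negz _ => 1
  end.

(* Main.v *)
(* (i) and (ii) are binomial expansions of ((1 + rho) + (1 - rho))^k and
   (2 + 2 rho)^k in disguise, and (iii) is the Chu-Vandermonde identity with
   parameters beta and beta + m.
   For (v), expanding multinomially, the left-hand side is n! times the
   coefficient of z^n in
     sum_i (rho z)^i (beta)^(i) / i! ((1 + z) (1 - (1 - rho) z))^(- beta - i)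
     = ((1 + z) (1 - (1 - rho) z) - rho z)^(- beta)
     = (1 - (1 - rho) z^2)^(- beta).
   In place of power series, the coefficients are computed by the recursion
   S(n + 1, beta) = 2 (1 - rho) n beta S(n - 1, beta + 1) that differentiating
   the last expression suggests.
   In (iv), the terms with a fixed l form a shifted copy of the case rho = 0 of
   the same sum, with parameter beta + l; what remains is the binomial
   expansion of (1 - rho)^(n / 2). *)

Require Import Defs.
From mathcomp Require Import ring zify.

Set Implicit Arguments.
Unset Strict Implicit.
Unset Printing Implicit Defensive.

Import Order.TTheory GRing.Theory Num.Theory.
Local Open Scope ring_scope.
Local Open Scope complex_scope.

(** Both sides run over the pairs with [i + p <= n]. *)
Lemma exchange_triangle (V : nmodType) (G : nat -> nat -> V) n :
  \sum_(i < n.+1) \sum_(p < (n - i).+1) G i p =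
  \sum_(p < n.+1) \sum_(i < (n - p).+1) G i p.
Proof.
have widen (H : nat -> V) i :
    \sum_(p < (n - i).+1) H p = \sum_(p < n.+1 | (p < (n - i).+1)%N) H p.
  by apply: big_ord_widen; lia.
under eq_bigr => i _ do rewrite (widen (G i)).
under [RHS]eq_bigr => p _ do rewrite (widen (G^~ p)).
rewrite (exchange_big_dep xpredT) //=; apply: eq_bigr => p _.
by apply: eq_bigl => i; have := ltn_ord i; have := ltn_ord p; lia.
Qed.

Section BinomialSums.
Variable F : fieldType.
Implicit Types (x y a b r s t : F) (f g : nat -> F) (n m : nat).

Lemma rise0 x : rise x 0 = 1.
Proof. by rewrite /rise big_ord0. Qed.

Lemma riseD x m n : rise x (m + n) = rise x m * rise (x + m%:R) n.
Proof.
rewrite /rise big_split_ord /=; congr (_ * _).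
by apply: eq_bigr => i _; rewrite natrD addrA.
Qed.

Lemma rise1 x : rise x 1 = x.
Proof. by rewrite /rise big_ord1 addr0. Qed.

Lemma riseSr x n : rise x n.+1 = rise x n * (x + n%:R).
Proof. by rewrite -addn1 riseD rise1. Qed.

Lemma riseSl x n : rise x n.+1 = x * rise (x + 1) n.
Proof. by rewrite -add1n riseD rise1. Qed.

(** * Binomial sums and exponential generating functions *)

Lemma sum_binS f n :
  \sum_(j < n.+2) 'C(n.+1, j)%:R * f j =
  \sum_(j < n.+1) 'C(n, j)%:R * (f j + f j.+1).
Proof.
under [RHS]eq_bigr do rewrite mulrDr.
rewrite big_split /= big_ord_recl bin0 mul1r.
under [X in _ + X = _]eq_bigr do rewrite lift0 binS natrD mulrDl.
rewrite big_split /= addrA; congr (_ + _).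
rewrite [RHS]big_ord_recl bin0 mul1r; congr (_ + _).
rewrite big_ord_recr /= bin_small // mul0r addr0.
by apply: eq_bigr.
Qed.

(** Absorption (n + 1 - j) C(n + 1, j) = (n + 1) C(n, j); the term j = n + 1 drops out. *)
Lemma sum_bin_absorb f n :
  \sum_(j < n.+2) 'C(n.+1, j)%:R * ((n.+1 - j)%:R * f j) =
  n.+1%:R * \sum_(j < n.+1) 'C(n, j)%:R * f j.
Proof.
rewrite big_ord_recr /= subnn mul0r mulr0 addr0 mulr_sumr.
apply: eq_bigr => i _; rewrite !mulrA -!natrM; congr (_%:R * _).
by rewrite mulnC mul_bin_down.
Qed.

(* The product of exponential generating functions. *)
Definition bconv f g n : F := \sum_(j < n.+1) 'C(n, j)%:R * (f j * g (n - j)%N).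

Lemma bconvC f g n : bconv f g n = bconv g f n.
Proof.
rewrite /bconv (reindex_inj rev_ord_inj) /=; apply: eq_bigr => j _.
have jn : (j <= n)%N := leq_ord j.
by rewrite subSS bin_sub // subKn // [f _ * _]mulrC.
Qed.

(** The Leibniz rule: shifting the coefficients differentiates the generating function. *)
Lemma bconvS f g n :
  bconv f g n.+1 = bconv (f \o succn) g n + bconv f (g \o succn) n.
Proof.
rewrite /bconv (sum_binS (fun j => f j * g (n.+1 - j)%N)) -big_split /=.
apply: eq_bigr => j _; rewrite subSS subSn ?leq_ord // -mulrDr.
by rewrite [_ + f j.+1 * _]addrC.
Qed.

(** The coefficient n! [z^n] (1 - t z)^(- x). *)
Definition risepow t x n : F := t ^+ n * rise x n.

Lemma bconv_risepow_succ t x f n :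
  bconv f (risepow t x \o succn) n =
  t * x * bconv f (risepow t (x + 1)) n.
Proof.
rewrite /bconv mulr_sumr; apply: eq_bigr => j _ /=.
by rewrite /risepow riseSl exprS; ring.
Qed.

(* Multiplying the generating function (1 - t z)^(- x - 1) by 1 - t z. *)
Lemma bconv_risepow_shift t x f n :
  bconv f (risepow t x) n =
  bconv f (risepow t (x + 1)) n
  - t * n%:R * bconv f (risepow t (x + 1)) n.-1.
Proof.
case: n => [|n]; first by rewrite /bconv !big_ord1 /risepow !rise0; ring.
rewrite -mulrA [n.+1.-1]/= {3}/bconv.
rewrite -(sum_bin_absorb (fun j => f j * risepow t (x + 1) (n - j)%N)).
rewrite mulr_sumr -sumrB; apply: eq_bigr => j _.
have := ltn_ord j; rewrite ltnS leq_eqVlt => /orP[/eqP->|jn].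
  by rewrite subnn /risepow !rise0; ring.
rewrite subSn // /risepow riseSl riseSr exprS.
by set d := (n - j)%N; rewrite -[d.+1]addn1 natrD; ring.
Qed.

(* n! [z^n] ((1 + z) (1 - s z))^(- x) *)
Definition quad s x n : F := bconv (risepow (- 1) x) (risepow s x) n.

(** The derivative of ((1 + z) (1 - s z))^(- x) is x (s - 1 + 2 s z) ((1 + z) (1 - s z))^(- x - 1).
    The factor z turns into [n] and an index shift, so [n.-1] is harmless at n = 0. After the
    Leibniz rule each product has one exponent - x left, which [bconv_risepow_shift] lowers to - x -
    1. *)
Lemma quadS s x n :
  quad s x n.+1 =
  x * ((s - 1) * quad s (x + 1) n + 2 * s * n%:R * quad s (x + 1) n.-1).
Proof.
rewrite /quad bconvS bconvC !bconv_risepow_succ.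
rewrite (bconvC (risepow s x)) (bconvC (risepow (-1) x)).
rewrite (bconv_risepow_shift s x) (bconv_risepow_shift (-1) x).
by rewrite !(bconvC (risepow s (x + 1)));  ring.
Qed.

(* n! [z^n] ((1 + z) (1 - s z) - r z)^(- x) *)
Definition quadsum r s x n : F :=
  \sum_(i < n.+1) 'C(n, i)%:R * (r ^+ i * rise x i * quad s (x + i%:R) (n - i)).

Lemma quadsumS r x n :
  quadsum r (1 - r) x n.+1 =
  2 * (1 - r) * n%:R * x * quadsum r (1 - r) (x + 1) n.-1.
Proof.
set s := 1 - r; pose q i := r ^+ i * rise (x + 1) i * quad s (x + 1 + i%:R) (n.-1 - i).
(* Pascal's rule pairs the terms i and i + 1. By [quadS] their multiples of
   [quad s (x + 1 + i%:R) (n - i)] have coefficients proportional to s - 1 and r, which cancel; only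
   the 2 s (n - i) part survives, and absorption applies to it. *)
transitivity (2 * s * x * \sum_(i < n.+1) 'C(n, i)%:R * ((n - i)%:R * q i)).
  rewrite /quadsum.
  rewrite (sum_binS (fun i => r ^+ i * rise x i * quad s (x + i%:R) (n.+1 - i))).
  rewrite mulr_sumr; apply: eq_bigr => i _.
  rewrite subSS subSn ?leq_ord // quadS /q.
  have -> : (n.-1 - i = (n - i).-1)%N by lia.
  have -> : x + i.+1%:R = x + 1 + i%:R by rewrite -addn1 natrD; ring.
  have e : rise x i * (x + i%:R) = x * rise (x + 1) i by rewrite -riseSr riseSl.
  have -> : x + i%:R + 1 = x + 1 + i%:R by ring.
  rewrite riseSl exprS.
  rewrite [r ^+ i * rise x i * _]mulrA -[r ^+ i * rise x i * _]mulrA e /s.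
  by ring.
case: n @q => [|n] q; first by rewrite big_ord1 sub0n; ring.
by rewrite sum_bin_absorb /quadsum /q /=; ring.
Qed.

(** Pascal's rule reduces n + 1 to n at (a, b) and at (a + 1, b + 1). Both have the same difference
    a - b, and the weights a + n and - b add up to the last factor of [rise (a - b) n.+1]. *)
Lemma chu_vandermonde a b n :
  \sum_(j < n.+1) 'C(n, j)%:R
     * ((-1) ^+ j * rise b j * rise (a + j%:R) (n - j)) = rise (a - b) n.
Proof.
elim: n a b => [|n IHn] a b.
  by rewrite big_ord1 !rise0 bin0 !mulr1.
rewrite (sum_binS (fun j => (-1) ^+ j * rise b j * rise (a + j%:R) (n.+1 - j))).
transitivity ((a + n%:R) * rise (a - b) n - b * rise (a + 1 - (b + 1)) n).
  rewrite -!IHn !mulr_sumr -sumrB; apply: eq_bigr => j _.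
  have jn : (j <= n)%N := leq_ord j.
  have e : a + n%:R = a + j%:R + (n - j)%:R by rewrite -addrA -natrD subnKC.
  have -> : a + j.+1%:R = a + 1 + j%:R by rewrite -addn1 natrD; ring.
  by rewrite subSS subSn // (riseSl b) riseSr exprS e; ring.
have -> : a + 1 - (b + 1) = a - b by ring.
by rewrite riseSr; ring.
Qed.

End BinomialSums.

Section CharZero.
Variable F : numFieldType.
Implicit Types (x r s : F) (n m : nat).

(** * Closed forms of the quadratic generating functions *)

Lemma fact_neq0 n : n`!%:R != 0 :> F.
Proof. by rewrite pnatr_eq0 -lt0n fact_gt0. Qed.

Lemma natr_bin n m : (m <= n)%N -> 'C(n, m)%:R = n`!%:R / (m`!%:R * (n - m)`!%:R) :> F.
Proof.
move=> mn; apply/(canRL (mulfK _)); first by rewrite mulf_neq0 ?fact_neq0.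
by rewrite -!natrM bin_fact.
Qed.

Lemma quadsum_odd r x h : quadsum r (1 - r) x h.*2.+1 = 0.
Proof.
elim: h x => [|h IHh] x; rewrite quadsumS; first by rewrite mulr0 !mul0r.
by rewrite IHh mulr0.
Qed.

Lemma quadsum_even r x h :
  quadsum r (1 - r) x h.*2 = h.*2`!%:R / h`!%:R * rise x h * (1 - r) ^+ h.
Proof.
elim: h x => [|h IHh] x.
  rewrite /quadsum big_ord1 /quad /bconv big_ord1 /risepow !rise0 !expr0 bin0 fact0.
  by field.
(* The recursion contributes 2 (2h + 1), the ratio of (2h + 2)! / (h + 1)! to (2h)! / h!. *)
rewrite doubleS quadsumS IHh riseSl exprS !factS !natrM.
have := fact_neq0 h; have : h.+1%:R != 0 :> F by rewrite pnatr_eq0.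
rewrite -addn1 -[h.*2.+2]addn2 -[h.*2.+1]addn1 -muln2 !natrD natrM => h1 h2.
by field; rewrite h1 h2.
Qed.

Lemma quadsumE r x n :
  quadsum r (1 - r) x n =
  if odd n then 0
  else n`!%:R / (n %/ 2)`!%:R * rise x (n %/ 2) * (1 - r) ^+ (n %/ 2).
Proof.
rewrite divn2; have := odd_double_half n; case: odd => /= nE.
  by rewrite -{1}nE quadsum_odd.
by rewrite -{1}nE quadsum_even -[in LHS](add0n n./2.*2) nE.
Qed.

(** At s = 1 the quadratic (1 + z) (1 - s z) is already 1 - z^2. *)
Lemma quad1_quadsum x n : quad 1 x n = quadsum 0 (1 - 0) x n.
Proof.
rewrite /quadsum big_ord_recl big1 => [|i _].
  by rewrite bin0 rise0 !addr0 subr0 subn0 expr0 !mul1r.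
by rewrite lift0 expr0n /= !mul0r mulr0.
Qed.

Lemma quad1_odd x h : quad 1 x h.*2.+1 = 0.
Proof. by rewrite quad1_quadsum quadsum_odd. Qed.

Lemma quad1_even x h : quad 1 x h.*2 = h.*2`!%:R / h`!%:R * rise x h.
Proof. by rewrite quad1_quadsum quadsum_even subr0 expr1n mulr1. Qed.

(** Put p = n - m and i = m - j, so that n - j = p + i. After the exchange of sums, C(n, p) C(n - p,
    i) = C(n, i) C(n - i, p), and [rise x (p + i)] splits at i, which leaves
    [quad s (x + i%:R) (n - i)] as the inner sum. *)
Lemma trinomial_reindex r s x n :
  \sum_(m < n.+1) (-1) ^+ (n - m) * 'C(n, m)%:R
     * \sum_(j < m.+1) 'C(m, j)%:R * s ^+ j * r ^+ (m - j)
         * rise x (n - j) * rise (x + (m - j)%:R) j =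
  quadsum r s x n.
Proof.
pose G i p := (-1) ^+ p * 'C(n, p)%:R * ('C(n - p, i)%:R * s ^+ (n - p - i) * r ^+ i
  * rise x (p + i) * rise (x + i%:R) (n - p - i)).
transitivity (\sum_(p < n.+1) \sum_(i < (n - p).+1) G i p).
  rewrite (reindex_inj rev_ord_inj) /=; apply: eq_bigr => p _.
  have pn := leq_ord p.
  rewrite subSS subKn // bin_sub // mulr_sumr (reindex_inj rev_ord_inj) /=.
  apply: eq_bigr => i _; have := leq_ord i => ip.
  rewrite subSS subKn // bin_sub // /G; congr (_ * (_ * _ * _ * rise _ _ * _)).
  by lia.
rewrite -exchange_triangle /quadsum; apply: eq_bigr => i _.
have iN := leq_ord i.
rewrite /quad /bconv !mulr_sumr; apply: eq_bigr => p _; have pn := leq_ord p.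
have -> : (n - i - p = n - p - i)%N by lia.
rewrite /G /risepow (addnC p) riseD !natr_bin; try lia.
have -> : (n - i - p = n - p - i)%N by lia.
by field; rewrite !fact_neq0.
Qed.

(** * Identity (iv): summation over m for fixed l *)

Lemma sum_shift_bin r x l N :
  \sum_(m < (l + N + l).+1)
    (-1) ^+ m * 'C(l + N + l, m)%:R * rise x m * rise x (l + N + l - m)
     * ('C(m, l)%:R * 'C(l + N + l - m, l)%:R * (r ^+ l * l`!%:R / rise x l)) =
  (- r) ^+ l * (l + N + l)`!%:R / (l`!%:R * N`!%:R) * rise x l * quad 1 (x + l%:R) N.
Proof.
set n := (l + N + l)%N.
pose T m := (-1) ^+ m * 'C(n, m)%:R * rise x m * rise x (n - m)
   * ('C(m, l)%:R * 'C(n - m, l)%:R * (r ^+ l * l`!%:R / rise x l)).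
(* The first and last blocks of length l vanish, as there m < l or n - m < l. In the middle, m = l +
   a, and both rising factorials split off [rise x l]. *)
transitivity (\sum_(m < l + N.+1 + l) T m); first by rewrite addnS addSn.
rewrite !big_split_ord /= [X in _ + X + _ = _](_ : _ = 
  \sum_(a < N.+1) T (l + a)%N) //.
rewrite big1 => [|a _]; last by rewrite /T (bin_small (ltn_ord a)) !(mul0r, mulr0).
rewrite [X in _ + X = _]big1 => [|a _]; last first.
  by rewrite /T ['C(_ - _, l)]bin_small ?(mul0r, mulr0) //; have := ltn_ord a; lia.
rewrite add0r addr0 /quad /bconv mulr_sumr; apply: eq_bigr => a _.
have aN := leq_ord a.
rewrite /T /risepow expr1n mul1r.
have -> : (n - (l + a) = l + (N - a))%N by lia.
rewrite !riseD !natr_bin; try lia.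
have -> : (n - (l + a) = l + (N - a))%N by lia.
rewrite !addKn exprD [(- r) ^+ l]exprNn.
(* Both sides carry a factor [rise x l], so they agree even where its inverse takes the default
   value 0. *)
have [->|xl0] := eqVneq (rise x l) 0; first by rewrite !(mul0r, mulr0).
by field; rewrite !fact_neq0 xl0.
Qed.

Lemma sum_binom_pochhammer r x n :
  \sum_(m < n.+1) (-1) ^+ m * 'C(n, m)%:R * rise x m * rise x (n - m)
    * \sum_(l < m.+1) 'C(m, l)%:R * 'C(n - m, l)%:R * (r ^+ l * l`!%:R / rise x l) =
  if odd n then 0
  else n`!%:R / (n %/ 2)`!%:R * rise x (n %/ 2) * (1 - r) ^+ (n %/ 2).
Proof.
pose T l m := (-1) ^+ m * 'C(n, m)%:R * rise x m * rise x (n - m)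
   * ('C(m, l)%:R * 'C(n - m, l)%:R * (r ^+ l * l`!%:R / rise x l)).
have T0 l m : (m < l)%N || (n - m < l)%N -> T l m = 0.
  by rewrite /T => /orP[] ml; rewrite (bin_small ml) !(mul0r, mulr0).
transitivity (\sum_(l < n.+1) \sum_(m < n.+1) T l m).
  rewrite exchange_big; apply: eq_bigr => m _; rewrite mulr_sumr.
  rewrite (big_ord_widen n.+1 (T^~ m)) 1?ltn_ord // big_mkcond /=.
  by apply: eq_bigr => l _; case: ltnP => // ml; rewrite T0 // ml.
rewrite divn2; set h := n./2.
have nE : n = (odd n + h.*2)%N by rewrite odd_double_half.
(* A nonzero term has l <= m and l <= n - m, hence 2 l <= n. *)
transitivity (\sum_(l < h.+1) \sum_(m < n.+1) T l m).
  rewrite [RHS](big_ord_widen n.+1 (fun l => \sum_(m < n.+1) T l m)); last by lia.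
  rewrite [RHS]big_mkcond; apply: eq_bigr => l _; case: ltnP => // hl.
  by rewrite big1 // => m _; rewrite T0 //; lia.
have sumT l : (l <= h)%N -> \sum_(m < n.+1) T l m =
    (- r) ^+ l * n`!%:R / (l`!%:R * (n - l.*2)`!%:R) * rise x l
    * quad 1 (x + l%:R) (n - l.*2).
  move=> lh; have e : n = (l + (n - l.*2) + l)%N by lia.
  by have := sum_shift_bin r x l (n - l.*2); rewrite -e => <-.
case: ifP nE => on; rewrite ?add0n ?add1n => nE.
  rewrite big1 // => l _; have lh := leq_ord l; rewrite sumT //.
  have -> : (n - l.*2 = (h - l).*2.+1)%N by lia.
  by rewrite quad1_odd mulr0.
(* The (n - 2l)! of [quad1_even] cancels the one in [sumT]; what remains is n! / h! times C(h, l) (-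
   r)^l. *)
rewrite exprDn mulr_sumr; apply: eq_bigr => l _; have lh := leq_ord l.
rewrite sumT //; have -> : (n - l.*2 = (h - l).*2)%N by lia.
rewrite quad1_even expr1n mul1r -[_ *+ 'C(_, _)]mulr_natr natr_bin //.
have -> : rise x h = rise x l * rise (x + l%:R) (h - l) by rewrite -riseD subnKC.
by field; rewrite !fact_neq0.
Qed.

(** * Identity (i): double factorials *)

Lemma dfact_even_pred j : (dfact ((2 * j)%N%:Z - 1) * (2 ^ j * j`!) = (2 * j)`!)%N.
Proof.
elim: j => [|j IHj] //.
have -> : (2 * j.+1)%N%:Z - 1 = (2 * j).+1%N%:Z by lia.
have -> : (2 * j.+1 = (2 * j).+2)%N by lia.
have e : dfact (2 * j).+1 = ((2 * j).+1 * dfact ((2 * j)%N%:Z - 1))%N.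
  (* At j = 0 this rests on the convention (-1)!! = 1. *)
  case: j {IHj} => [|j] //.
  have -> : (2 * j.+1)%N%:Z - 1 = (2 * j).+1%N%:Z by lia.
  by have -> : (2 * j.+1 = (2 * j).+2)%N by lia.
by rewrite e !factS -IHj expnS; lia.
Qed.

Lemma natr_dfact_even_pred j :
  (dfact ((2 * j)%N%:Z - 1))%:R = (2 * j)`!%:R / (2 ^+ j * j`!%:R) :> F.
Proof.
have nz : 2 ^+ j * j`!%:R != 0 :> F by rewrite mulf_neq0 ?fact_neq0 ?expf_neq0 ?pnatr_eq0.
by apply/(canRL (mulfK nz)); rewrite -natrX -!natrM dfact_even_pred.
Qed.

(** C(2k, 2j) (2j - 1)!! (2k - 2j - 1)!! = (2k)! / (2^k k!) C(k, j), and the powers are (1 + r)^k (1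
    + r)^(k - j) (1 - r)^j. *)
Lemma sum_double_factorial r k :
  (2 * k)`!%:R / k`!%:R * (1 + r) ^+ k =
  \sum_(j < k.+1)
    'C(2 * k, 2 * j)%:R * (1 + r) ^+ (2 * k - 2 * j) * (1 - r ^+ 2) ^+ j
    * (dfact ((2 * j)%N%:Z - 1))%:R * (dfact ((2 * k - 2 * j)%N%:Z - 1))%:R.
Proof.
have two_neq0 i : 2 ^+ i != 0 :> F by rewrite expf_neq0 ?pnatr_eq0.
transitivity ((2 * k)`!%:R / k`!%:R * ((1 + r) ^+ k * ((1 + r) + (1 - r)) ^+ k / 2 ^+ k)).
  have -> : (1 + r) + (1 - r) = 2 by ring.
  by rewrite mulfK.
rewrite [(1 + r + _) ^+ k]exprDn mulr_sumr mulr_suml mulr_sumr; apply: eq_bigr => j _.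
have jk := leq_ord j.
rewrite -!mulnBr !natr_dfact_even_pred natr_bin ?leq_mul2l // -mulnBr.
rewrite -[_ *+ 'C(_, _)]mulr_natr natr_bin //.
have -> : 1 - r ^+ 2 = (1 + r) * (1 - r) by ring.
have e x : x ^+ k = x ^+ (k - j) * x ^+ j :> F by rewrite -exprD subnK.
rewrite exprMn !e [in _ ^+ (2 * (k - j))]mulnC exprM.
by field; rewrite !fact_neq0 !two_neq0.
Qed.

(** With i = j - 2m, the summand is a term of (2 r + (1 + 1))^k expanded first in i, then in m. *)
Lemma sum_binom_trinomial r k :
  (1 + r) ^+ k =
  1 / 2 ^+ k * \sum_(j < (2 * k).+1) \sum_(m < (j %/ 2).+1)
    (2 * r) ^+ (j - 2 * m) * 'C(k, j - 2 * m)%:R * 'C(k + 2 * m - j, m)%:R.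
Proof.
pose G i m : F := (2 * r) ^+ i * 'C(k, i)%:R * 'C(k - i, m)%:R.
have G0 i m : (k < i + m)%N -> G i m = 0.
  rewrite /G => kim; case: (ltnP k i) => ik; first by rewrite (bin_small ik) mulr0 mul0r.
  by rewrite (@bin_small (k - i)) ?mulr0 //; lia.
have -> : (1 + r) ^+ k = 1 / 2 ^+ k * \sum_(i < k.+1) \sum_(m < k.+1) G i m.
  have -> : 1 + r = (2 + 2 * r) / 2 by field.
  rewrite expr_div_n mulrC div1r; congr (_ * _).
  rewrite exprDn; apply: eq_bigr => i _; have ik := leq_ord i.
  rewrite -mulr_sumr -[_ *+ 'C(_, _)]mulr_natr [2 ^+ _ * _]mulrC -!mulrA; congr (_ * _).
  rewrite mulrC; congr (_ * _).
  rewrite -[2]/(1 + 1) exprDn (big_ord_widen k.+1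
    (fun m => (1 ^+ (k - i - m) * 1 ^+ m) *+ 'C(k - i, m))); last by lia.
  rewrite big_mkcond; apply: eq_bigr => m _; rewrite !expr1n mulr1.
  by case: ltnP => // h; rewrite bin_small.
congr (_ * _).
(* A one-term sum over j = i + 2m changes variables; nonzero terms have i + m <= k, hence j <=
   2k. *)
transitivity (\sum_(i < k.+1) \sum_(m < k.+1)
    \sum_(j < (2 * k).+1 | j == (i + 2 * m)%N :> nat) G i m).
  apply: eq_bigr => i _; apply: eq_bigr => m _.
  have [kim|kim] := ltnP k (i + m); first by rewrite G0 // big1.
  have jk : (i + 2 * m < (2 * k).+1)%N by have := leq_ord i; lia.
  by rewrite (big_pred1 (Ordinal jk)).
under eq_bigr do rewrite (exchange_big_dep xpredT) //=.
rewrite exchange_big; apply: eq_bigr => j _.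
rewrite (exchange_big_dep xpredT) //=.
rewrite (big_ord_widen k.+1 (fun m => (2 * r) ^+ (j - 2 * m)
    * 'C(k, j - 2 * m)%:R * 'C(k + 2 * m - j, m)%:R));
  last by have := leq_ord j; lia.
rewrite [RHS]big_mkcond; apply: eq_bigr => m _.
case: ltnP => mj; last first.
  by rewrite big_pred0 => [|i] //; lia.
have -> : (k + 2 * m - j = k - (j - 2 * m))%N by lia.
rewrite -/(G (j - 2 * m)%N m); have [jk|jk] := leqP (j - 2 * m) k.
  rewrite (big_pred1 (Ordinal (jk : j - 2 * m < k.+1)%N)) // => i.
  by rewrite -[RHS]val_eqE /=; lia.
by rewrite big_pred0 ?G0 // => [|i]; [lia | have := ltn_ord i; lia].
Qed.

(** * Identity (iii): rising factorials of integer order *)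

Lemma risez_add x (m : int) j :
  (forall i : nat, (0 < i)%N -> i%:Z <= - m -> x != i%:R) ->
  risez x (j%:Z + m) = risez x m * rise (x + m%:~R) j.
Proof.
move=> xm; elim: j => [|j IHj]; first by rewrite add0r rise0 mulr1.
rewrite riseSr mulrA -IHj.
have -> : j.+1%:Z + m = j%:Z + m + 1 by lia.
have -> : x + m%:~R + j%:R = x + (j%:Z + m)%:~R by rewrite intrD -pmulrn; ring.
have : forall i : nat, (0 < i)%N -> i%:Z <= - (j%:Z + m) -> x != i%:R.
  by move=> i i0 ij; apply: xm => //; lia.
case: (j%:Z + m) => [q|q] xq; first by rewrite -PoszD addn1 /= riseSr.
rewrite NegzE in xq *.
have xq1 : x - q.+1%:R != 0 by rewrite subr_eq0 xq //; lia.
have -> : - q.+1%:Z + 1 = - q%:Z by lia.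
have -> : x + (- q.+1%:Z)%:~R = x - q.+1%:R by rewrite rmorphN.
(* Order -1 steps to 0, leaving the reciprocal branch; below it, the lowest factor of the reciprocal
   cancels. *)
case: q {xq} xq1 => [|q] xq1; first by rewrite oppr0 /= rise1 rise0 mulVf.
rewrite -!NegzE /= [rise (x - q.+2%:R) _]riseSl.
have -> : x - q.+2%:R + 1 = x - q.+1%:R by rewrite -[q.+2]addn1 natrD; ring.
by rewrite invfM mulrAC mulVf ?mul1r.
Qed.

Lemma rise_oppz (m : int) n :
  rise (- m%:~R) n = (-1) ^+ n * n`!%:R * binz m n :> F.
Proof.
have -> : (-1) ^+ n * n`!%:R * binz m n = (-1) ^+ n * (\prod_(i < n) (m - i%:Z))%:~R :> F.
  by rewrite /binz -mulrA [n`!%:R * _]mulrC mulfVK ?fact_neq0.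
rewrite rmorph_prod -[n in (-1) ^+ n]card_ord -prodrN; apply: eq_bigr => i _.
by rewrite rmorphB opprB addrC.
Qed.

Lemma alternating_sum_risez x n (m : int) :
  (forall i : nat, (i < n)%N -> x != - i%:R) ->
  (forall i : nat, (0 < i)%N -> i%:Z <= - m -> x != i%:R) ->
  \sum_(j < n.+1) (-1) ^+ j * 'C(n, j)%:R * (risez x (j%:Z + m) / rise x j) =
  (-1) ^+ n * n`!%:R * binz m n * (risez x m / rise x n).
Proof.
move=> xn xm.
have xn0 : rise x n != 0.
  by apply/prodf_neq0 => i _; rewrite addr_eq0 xn.
apply: (mulIf xn0); rewrite -rise_oppz -!mulrA mulVf // mulr1.
(* This fixes a = x and b = x + m in [chu_vandermonde]; [risez_add] supplies the common factor
   [risez x m]. *)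
have -> : - m%:~R = x - (x + m%:~R) by ring.
rewrite -chu_vandermonde !mulr_suml; apply: eq_bigr => j _.
have e : rise x n = rise x j * rise (x + j%:R) (n - j) by rewrite -riseD subnKC ?leq_ord.
have xj0 : rise x j != 0 by move: xn0; rewrite e mulf_eq0 => /norP[].
rewrite risez_add // e; by field.
Qed.

End CharZero.

Theorem theorem1 (R : realType) (k : nat) (rho beta : R[i]) :
  [/\ (* (i) *)
      (2 * k)`!%:R / k`!%:R * (1 + rho) ^+ k =
      \sum_(j < k.+1)
        'C(2 * k, 2 * j)%:R * (1 + rho) ^+ (2 * k - 2 * j)
        * (1 - rho ^+ 2) ^+ j
        * (dfact ((2 * j)%N%:Z - 1))%:R
        * (dfact ((2 * k - 2 * j)%N%:Z - 1))%:R,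
      (* (ii) *)
      (1 + rho) ^+ k =
      1 / 2 ^+ k *
      \sum_(j < (2 * k).+1) \sum_(m < (j %/ 2).+1)
        (2 * rho) ^+ (j - 2 * m) * 'C(k, j - 2 * m)%:R
        * 'C(k + 2 * m - j, m)%:R,
      (* (iii) *)
      forall (n : nat) (m : int),
        (forall i : nat, (i < n)%N -> beta != - i%:R) ->
        (forall i : nat, (0 < i)%N -> i%:Z <= - m -> beta != i%:R) ->
        \sum_(j < n.+1)
          (-1) ^+ j * 'C(n, j)%:R * (risez beta (j%:Z + m) / rise beta j) =
        (-1) ^+ n * n`!%:R * binz m n * (risez beta m / rise beta n),
      (* (iv) *)
      forall n : nat,
        \sum_(m < n.+1)
          (-1) ^+ m * 'C(n, m)%:R * rise beta m * rise beta (n - m)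
          * \sum_(l < m.+1)
              'C(m, l)%:R * 'C(n - m, l)%:R
              * (rho ^+ l * l`!%:R / rise beta l) =
        if odd n then 0
        else n`!%:R / (n %/ 2)`!%:R * rise beta (n %/ 2)
             * (1 - rho) ^+ (n %/ 2)
    & (* (v) *)
      forall n : nat,
        \sum_(m < n.+1)
          (-1) ^+ (n - m) * 'C(n, m)%:R
          * \sum_(j < m.+1)
              'C(m, j)%:R * (1 - rho) ^+ j * rho ^+ (m - j)
              * rise beta (n - j) * rise (beta + (m - j)%:R) j =
        if odd n then 0
        else n`!%:R / (n %/ 2)`!%:R * rise beta (n %/ 2)
             * (1 - rho) ^+ (n %/ 2)].
Proof.
split.
- exact: sum_double_factorial.
- exact: sum_binom_trinomial.
- exact: alternating_sum_risez.
- exact: sum_binom_pochhammer.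
- by move=> n; rewrite trinomial_reindex quadsumE.
Qed.
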